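(* Let $(X,f)$ be a topological dynamical system. If a pair $(x_1,x_2)\in X^2$ is distributionally scrambled of type $2\frac12$, then it is Li-Yorke scrambled.
   Context: A topological dynamical system $(X,f)$ consists of a non-empty compact metric space $(X,d)$ and a continuous map $f:X\to X$. A pair of distinct points $(x_1,x_2)\in X^2$ is (Li-Yorke) scrambled if $\liminf_{k\to\infty} d(f^k(x_1),f^k(x_2))=0$ and $\limsup_{k\to\infty} d(f^k(x_1),f^k(x_2))>0$. For $(x_1,x_2)\in X^2$ and $\delta>0$ put $$\Phi_{(x_1,x_2)}(\delta)=\liminf_{m\to\infty}\frac1m\#\{0\le k\le m: d(f^k(x_1),f^k(x_2))<\delta\},$$ $$\Phi^*_{(x_1,x_2)}(\delta)=\limsup_{m\to\infty}\frac1m\#\{0\le k\le m: d(f^k(x_1),f^k(x_2))<\delta\}.$$ A pair $(x_1,x_2)\in X^2$ is distributionally scrambled of type $2\frac12$ if there are positive numbers $c$ and $s$ such that $\Phi_{(x_1,x_2)}(\delta)<c<\Phi^*_{(x_1,x_2)}(\delta)$ for every $0<\delta<s$. *)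

(* Defs.v *)
From HB Require Import structures.
From mathcomp Require Import all_boot all_order all_algebra.
From mathcomp Require Import all_classical all_reals all_analysis.

Set Implicit Arguments.
Unset Strict Implicit.
Unset Printing Implicit Defensive.

Import Order.TTheory GRing.Theory Num.Theory.

Local Open Scope classical_set_scope.
Local Open Scope ring_scope.

(* Lower and upper limits are taken in [\bar R], where they always exist
   ([limn_inf]/[limn_sup] on [R] are only meaningful for bounded sequences). *)

Definition topological_dynamical_system (R : realType) (X : metricType R)
    (f : X -> X) : Prop :=
  [/\ [set: X] !=set0, compact [set: X] & continuous f].

Definition orbit_dist (R : realType) (X : metricType R) (f : X -> X)
    (x1 x2 : X) (k : nat) : R :=
  mdist (iter k f x1) (iter k f x2).

Definition li_yorke_scrambled (R : realType) (X : metricType R) (f : X -> X)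
    (x1 x2 : X) : Prop :=
  [/\ x1 <> x2,
      limn_einf (fun k => (orbit_dist f x1 x2 k)%:E) = 0%E
    & (0 < limn_esup (fun k => (orbit_dist f x1 x2 k)%:E))%E].

(* The index runs over 0 <= k <= m, i.e. m + 1 values, but the normalisation is
   by m; the term at m = 0, where the inverse is 0, does not affect limits. *)
Definition close_freq (R : realType) (X : metricType R) (f : X -> X)
    (x1 x2 : X) (delta : R) (m : nat) : R :=
  m%:R^-1 * #|[pred k : 'I_m.+1 | orbit_dist f x1 x2 k < delta]|%:R.

Definition Phi (R : realType) (X : metricType R) (f : X -> X)
    (x1 x2 : X) (delta : R) : \bar R :=
  limn_einf (fun m => (close_freq f x1 x2 delta m)%:E).

Definition Phi_star (R : realType) (X : metricType R) (f : X -> X)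
    (x1 x2 : X) (delta : R) : \bar R :=
  limn_esup (fun m => (close_freq f x1 x2 delta m)%:E).

Definition dist_scrambled_2half (R : realType) (X : metricType R) (f : X -> X)
    (x1 x2 : X) : Prop :=
  exists c s : R, [/\ 0 < c, 0 < s &
    forall delta : R, 0 < delta -> delta < s ->
      (Phi f x1 x2 delta < c%:E)%E /\ (c%:E < Phi_star f x1 x2 delta)%E].

(* Main.v *)
Require Import Defs.
From mathcomp Require Import all_boot all_order all_algebra.
From mathcomp Require Import all_classical all_reals all_analysis.
From mathcomp Require Import ring.

(** For [0 < delta < s] the close-visit frequencies of a pair of type 2 1/2 have
    distinct lower and upper limits, so the test [d (f^k x1) (f^k x2) < delta]
    is not eventually constant in [k]: an eventually constant test with value
    [b] makes the frequencies converge to [b]. Since the test holds infinitely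
    often for every small [delta], the lower limit of the distances is 0; since
    it also fails infinitely often, their upper limit is positive. *)

Import Order.TTheory GRing.Theory Num.Theory.
Import numFieldNormedType.Exports.

Local Open Scope classical_set_scope.
Local Open Scope ring_scope.

Lemma limn_esup_lt_near {R : realType} {u : (\bar R)^nat} {l : \bar R} :
  (limn_esup u < l)%E -> \forall n \near \oo, (u n < l)%E.
Proof.
(* [limn_esup] is an infimum, over sets [V] near infinity, of the supremum of [u] on [V]; some [V]
   already has its supremum below [l]. *)
move=> /ereal_inf_lt[_ [V Voo <-] supV].
apply: filterS Voo => n Vn; apply: le_lt_trans supV.
by apply: ereal_sup_ubound; exists n.
Qed.

Lemma lt_limn_einf_near {R : realType} {u : (\bar R)^nat} {l : \bar R} :
  (l < limn_einf u)%E -> \forall n \near \oo, (l < u n)%E.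
Proof.
rewrite /limn_einf lteNr => /limn_esup_lt_near.
by apply: filterS => n; rewrite lteNl oppeK.
Qed.

Lemma limn_einf_ge {R : realType} {u : (\bar R)^nat} {l : \bar R} :
  (forall n, l <= u n)%E -> (l <= limn_einf u)%E.
Proof.
move=> leu; rewrite limn_einf_lim; apply: lime_ge; first exact: is_cvg_einfs.
by apply: nearW => n; apply: le_ereal_inf_tmp => _ [k _ <-].
Qed.

(** Splitting the range at [N] leaves a fixed initial count and a tail where each index contributes
    [b], so the count is affine in [m] with slope [b]. *)
Lemma card_pred_affine (P : pred nat) (b : bool) (N m : nat) :
  (forall k, (N <= k)%N -> P k = b) -> (N <= m.+1)%N ->
  #|[pred k : 'I_m.+1 | P k]| = (#|[pred k : 'I_N | P k]| + b * (m.+1 - N))%N.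
Proof.
move=> Pb leNm.
rewrite -!sum1_card -(big_mkord P (fun=> 1%N)) (big_cat_nat (leq0n _) leNm)/= big_mkord.
congr addn; rewrite big_mkcond /= (eq_big_nat _ _ (F2 := fun=> nat_of_bool b)).
  by rewrite sum_nat_const_nat mulnC.
by move=> k /andP[/Pb -> _]; case: b {Pb}.
Qed.

Lemma cvg_affine_div {R : realType} (a K : R) :
  m%:R^-1 * (a * m%:R + K) @[m --> \oo] --> a.
Proof.
(* The shift skips [m = 0], where the inverse is 0 and cancelling [m] would fail. *)
rewrite -cvg_shiftS /=.
under eq_cvg => m do
  rewrite mulrDr mulrCA mulVf ?pnatr_eq0// mulr1 mulrC.
have harm0 : K * harmonic m @[m --> \oo] --> K * 0.
  by apply: cvgMl_tmp; exact: cvg_harmonic.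
by have := cvgD (cvg_cst a) harm0; rewrite mulr0 addr0; apply.
Qed.

Section OrbitDistance.
Context {R : realType} {X : metricType R} {f : X -> X} {x1 x2 : X}.

Lemma close_freq_cvg {delta : R} {b : bool} :
  (\forall k \near \oo, (orbit_dist f x1 x2 k < delta) = b) ->
  close_freq f x1 x2 delta m @[m --> \oo] --> (b%:R : R).
Proof.
move=> [N _ Nb].
(* The part of the count independent of [m]: the visits before [N], and the offset from the tail
   length [m + 1 - N]. *)
pose K : R := #|[pred k : 'I_N | orbit_dist f x1 x2 k < delta]|%:R
  + b%:R * (1 - N%:R).
apply: cvg_trans (cvg_affine_div b%:R K); apply: near_eq_cvg.
exists N => // m /= leNm.
rewrite /close_freq (card_pred_affine (fun k => orbit_dist f x1 x2 k < delta) b N)//.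
  by rewrite natrD natrM natrB ?leqW// -natr1 /K; ring.
exact: leqW.
Qed.

Lemma dist_scrambled_2half_not_near :
  dist_scrambled_2half f x1 x2 ->
  exists2 s : R, 0 < s & forall (delta : R) (b : bool), 0 < delta < s ->
    ~ \forall k \near \oo, (orbit_dist f x1 x2 k < delta) = b.
Proof.
move=> [c [s [_ s0 Phi_c]]]; exists s => // delta b /andP[delta0 deltas].
move=> /close_freq_cvg freq_cvg.
have [] : Phi f x1 x2 delta = b%:R%:E /\ Phi_star f x1 x2 delta = b%:R%:E.
  have [] // := @cvg_limn_einf_sup _ (fun m => (close_freq f x1 x2 delta m)%:E) b%:R%:E.
  by apply: cvg_EFin => //; exact: nearW.
move=> PhiE Phi_starE.
have [] := Phi_c _ delta0 deltas.
by rewrite PhiE Phi_starE => /lt_trans/[apply]; rewrite ltxx.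
Qed.

End OrbitDistance.

Theorem mainTheorem5 (R : realType) (X : metricType R) (f : X -> X)
    (Xf : topological_dynamical_system f) (x1 x2 : X)
    (x12 : dist_scrambled_2half f x1 x2) :
  li_yorke_scrambled f x1 x2.
Proof.
have [s s0 not_near] := dist_scrambled_2half_not_near x12.
have s2 : 0 < s / 2 < s by rewrite divr_gt0//= ltr_pdivrMr// ltr_pMr// ltr1n.
split.
- move=> x12E; apply: (not_near (s / 2) true s2); apply: nearW => k.
  by rewrite x12E /orbit_dist mdistxx; case/andP: s2.
- apply/eqP; rewrite eq_le; apply/andP; split; last first.
    by apply: limn_einf_ge => k; rewrite lee_fin mdist_ge0.
  apply/lee_addgt0Pr => e e0; rewrite add0e.
  (* The threshold must be below [s] for [not_near] to apply, and at most [e] so that distances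
     above [e] fail the test. *)
  have d0s : 0 < Num.min e (s / 2) < s.
    by case/andP: s2 => d0 ds; rewrite lt_min e0 d0 gt_min ds orbT.
  rewrite leNgt; apply/negP => e_lt; apply: (not_near _ false d0s).
  apply: filterS (lt_limn_einf_near e_lt) => k; rewrite lte_fin => e_ltk.
  by apply/negbTE; rewrite -leNgt ge_min (ltW e_ltk).
(* An upper limit at most 0 would put the distances eventually below [s / 2]. *)
- rewrite ltNge; apply/negP => le0; apply: (not_near _ true s2).
  have /limn_esup_lt_near : (limn_esup (fun k => (orbit_dist f x1 x2 k)%:E) < (s / 2)%:E)%E.
    by apply: le_lt_trans le0 _; rewrite lte_fin; case/andP: s2.
  by apply: filterS => k; rewrite lte_fin.
Qed.
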